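(* Let $n\ge5$. The $\mathscr{D}^*$-classes of $\mathcal{E}_n=\mathrm{End}(\mathcal{T}_n)$ are $\mathcal{G}_n$, $E_1$ and $\mathcal{E}_n\setminus(\mathcal{G}_n\cup E_1)$, and further, $\mathscr{D}^*=\mathscr{J}^*$.
   Context: Maps are written on the right and composed left to right. $\mathcal{T}_n$ is the full transformation semigroup of all maps $\{1,\dots,n\}\to\{1,\dots,n\}$; $\mathcal{S}_n$, $\mathcal{A}_n$ are the symmetric and alternating groups. $\mathcal{E}_n=\mathrm{End}(\mathcal{T}_n)$ is the monoid of all semigroup endomorphisms of $\mathcal{T}_n$ (not required to fix the identity map), and $\mathcal{G}_n=\mathrm{Aut}(\mathcal{T}_n)$. For $t,e\in\mathcal{T}_n$, $\phi_{t,e}$ sends $s\mapsto t$ if $s\in\mathcal{S}_n\setminus\mathcal{A}_n$, $s\mapsto t^2$ if $s\in\mathcal{A}_n$, $s\mapsto e$ if $s\in\mathcal{T}_n\setminus\mathcal{S}_n$. By a known theorem of Schein and Teclezghi, $\mathcal{G}_n=\{\psi_g:g\in\mathcal{S}_n\}$ with $\psi_g:s\mapsto g^{-1}sg$ and, for $n\neq4$, $\mathcal{E}_n=\mathcal{G}_n\cup\{\phi_{t,e}: t^3=t,\ te=et=e^2=e\}$. $E_1=\{\phi_{e,e}\in\mathcal{E}_n\}$, the set of endomorphisms whose image has exactly one element. Relations on $\mathcal{E}_n$: $\alpha\mathrel{\mathscr{R}^*}\beta$ iff for all $\gamma,\delta\in\mathcal{E}_n$, $\gamma\alpha=\delta\alpha\Leftrightarrow\gamma\beta=\delta\beta$;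 $\alpha\mathrel{\mathscr{L}^*}\beta$ iff for all $\gamma,\delta\in\mathcal{E}_n$, $\alpha\gamma=\alpha\delta\Leftrightarrow\beta\gamma=\beta\delta$; $\mathscr{D}^*=\mathscr{L}^*\vee\mathscr{R}^*$ (the smallest equivalence relation containing both); $\alpha\mathrel{\mathscr{J}^*}\beta$ iff $J^*(\alpha)=J^*(\beta)$, where $J^*(\alpha)$ is the smallest ideal of $\mathcal{E}_n$ containing $\alpha$ that is saturated by (i.e. is a union of classes of) both $\mathscr{L}^*$ and $\mathscr{R}^*$. *)

(* Defs.v *)
From HB Require Import structures.
From mathcomp Require Import all_boot all_fingroup.
From mathcomp Require Import boolp classical_sets.

Set Implicit Arguments.
Unset Strict Implicit.
Unset Printing Implicit Defensive.

Local Open Scope classical_set_scope.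
Local Open Scope group_scope.

(* An alias of {ffun 'I_n -> 'I_n}, because the latter may inherit a pointwise
   product.  Maps act on the right: s * t is s followed by t. *)
Definition transf (n : nat) : Type := {ffun 'I_n -> 'I_n}.
HB.instance Definition _ n := Finite.copy (transf n) {ffun 'I_n -> 'I_n}.

Section TransfMonoid.
Variable n : nat.
Implicit Types s t u : transf n.

Definition transf_mul s t : transf n := [ffun i : 'I_n => t (s i)].
Definition transf_one : transf n := [ffun i : 'I_n => i].

Lemma transf_mulA : associative transf_mul.
Proof. by move=> s t u; apply/ffunP => i; rewrite !ffunE. Qed.

Lemma transf_mul1g : left_id transf_one transf_mul.
Proof. by move=> s; apply/ffunP => i; rewrite !ffunE. Qed.

Lemma transf_mulg1 : right_id transf_one transf_mul.
Proof. by move=> s; apply/ffunP => i; rewrite !ffunE. Qed.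

End TransfMonoid.

HB.instance Definition _ n :=
  isMonoid.Build (transf n) (@transf_mulA n) (@transf_mul1g n) (@transf_mulg1 n).

(* All semigroup endomorphisms; preservation of 1 is not required, even when S
   is a monoid.  The product f * g is f followed by g. *)
Definition endo (S : semigroupType) : Type := {multiplicative S -> S}.

Section EndoMonoid.
Variable S : semigroupType.
Implicit Types f g h : endo S.

HB.instance Definition _ := gen_eqMixin (endo S).
HB.instance Definition _ := gen_choiceMixin (endo S).

Lemma endoP f g : f =1 g -> f = g.
Proof.
case: f g => [f [[Hf]]] [g [[Hg]]] /= /funext fg.
by rewrite fg in Hf *; rewrite (Prop_irrelevance Hf Hg).
Qed.

Definition endo_mul f g : endo S := g \o f.
Definition endo_one : endo S := idfun.

Lemma endo_mulA : associative endo_mul.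
Proof. by move=> f g h; apply: endoP. Qed.

Lemma endo_mul1g : left_id endo_one endo_mul.
Proof. by move=> f; apply: endoP. Qed.

Lemma endo_mulg1 : right_id endo_one endo_mul.
Proof. by move=> f; apply: endoP. Qed.

HB.instance Definition _ :=
  isMonoid.Build (endo S) endo_mulA endo_mul1g endo_mulg1.

Definition autos : set (endo S) := [set f | bijective f].

End EndoMonoid.

Arguments autos S : clear implicits.

(* On a monoid the defining conditions of R* and L*, usually quantified over
   S^1, are quantified over M itself. *)
Section StarredGreen.
Variable M : monoidType.
Implicit Types (a b x y : M) (Q : M -> M -> Prop) (I : set M).

Definition Rstar a b : Prop := forall x y, x * a = y * a <-> x * b = y * b.

Definition Lstar a b : Prop := forall x y, a * x = a * y <-> b * x = b * y.

Definition Dstar a b : Prop :=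
  forall Q, RelationClasses.Equivalence Q ->
    (forall x y, Lstar x y -> Q x y) ->
    (forall x y, Rstar x y -> Q x y) -> Q a b.

Definition ideal I : Prop := forall a x, I a -> I (x * a) /\ I (a * x).

Definition saturated Q I : Prop := forall a b, Q a b -> I a -> I b.

Definition star_ideal I : Prop :=
  [/\ ideal I, saturated Lstar I & saturated Rstar I].

Definition Jstar_ideal a : set M := smallest star_ideal [set a].

Definition Jstar a b : Prop := Jstar_ideal a = Jstar_ideal b.

Definition Dstar_classes : set (set M) :=
  [set X | exists a, X = [set b | Dstar a b]].

End StarredGreen.

Arguments Dstar_classes M : clear implicits.

Section Phi.
Variable n : nat.
Implicit Types s t e : transf n.

(* [insub s] is [Some p] when s is a permutation p, and [None] when s is not
   injective; [odd_perm p] says that p is not in the alternating group. *)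
Definition phi t e s : transf n :=
  if insub (s : {ffun 'I_n -> 'I_n}) is Some p then
    if odd_perm (p : {perm 'I_n}) then t else t * t
  else e.

Definition E1 : set (endo (transf n)) :=
  [set a | exists e, (a : transf n -> transf n) = phi e e].

Lemma phi_idem e s : e * e = e -> phi e e s = e.
Proof. by move=> ee; rewrite /phi; case: insub => // p; rewrite ee if_same. Qed.

Lemma E1_image_singleton (a : endo (transf n)) :
  (1 < n)%N -> E1 a <-> exists e, range a = [set e].
Proof.
move=> n_gt1; split=> [[e ae]|[e ae]]; exists e; last first.
  have ac s : a s = e by have : range a (a s) by [exists s]; rewrite ae.
  by apply/funext => s; rewrite phi_idem // -[in LHS](ac 1) -gmulfM ac.
pose i0 := Ordinal (ltnW n_gt1); pose i1 := Ordinal n_gt1.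
pose c : transf n := [ffun=> i0].
have cc : c * c = c by apply/ffunP => i; rewrite !ffunE.
have ac : a c = e.
  rewrite ae /phi insubN //; apply/negP => /injectiveP /(_ i0 i1).
  by rewrite !ffunE => /(_ erefl).
have ee : e * e = e by rewrite -ac -gmulfM cc.
apply/seteqP; split=> [_ [s _ <-]|_ ->]; last by exists c.
by rewrite ae /= phi_idem.
Qed.

End Phi.

Arguments E1 n : clear implicits.

(* Main.v *)
Require Import Defs.
From HB Require Import structures.
From mathcomp Require Import all_boot all_fingroup.
From mathcomp Require Import boolp classical_sets.
From mathcomp Require Import gseries alt.

Set Implicit Arguments.
Unset Strict Implicit.

(** Write [T_n] for [transf n].  An endomorphism of [T_n] that is not bijective
    sees only whether its argument is an odd permutation, an even permutation
    or singular, that is, it is [phi t e] for some [t] and [e]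
    ([not_auto_phi]).  Indeed an endomorphism that is injective on permutations
    is injective on constant maps, hence injective
    ([injective_on_perms_bij]); one that is not injective on permutations is
    trivial on the alternating group, which is simple as [n >= 5], and there are
    enough even permutations for this to force it to identify all singular maps
    ([sing_collapse]).

    Automorphisms are cancellable and [phi t e] is cancellable on neither side,
    so the automorphisms are a union of classes of both relations; so are the
    constant endomorphisms, which make up [E1].  Hence the three sets of the
    theorem are not merged by [Dstar].

    Automorphisms are [Lstar]-related to each other because they are
    cancellable, and constant endomorphisms are [Rstar]-related because they
    have the same kernel.  It remains to connect the endomorphisms [phi t e] with [t != e].  Two of
    them with the same kernel are [Rstar]-related, and there are two possible
    kernels, according to whether [t * t = t].  One [Lstar]-pair links the two
    kinds.  With [flip x y z] the map that swaps [y] and [z] and sends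
    everything else to [x], the endomorphisms [phi flip (cst x)] and
    [phi (flip * flip) (cst x)] are [Lstar]-related, since an endomorphism is
    determined on [flip] by its values on [flip * flip] and [cst x]: for an
    automorphism, a permutation that fixes [x] and commutes with [flip * flip]
    preserves the pair of [y] and [z], so commutes with [flip]
    ([flip_comm], [flip_Lstar]).

    Finally [Dstar] is contained in [Jstar] in any monoid, and conversely [E1]
    and the complement of the automorphisms are starred ideals, which suffice
    to separate the three classes. *)

(** * Starred Green relations in a monoid *)

Section StarredRelations.
Local Open Scope classical_set_scope.
Local Open Scope group_scope.
Variable M : monoidType.
Implicit Types a b : M.

Lemma Lstar_sym a b : Lstar a b -> Lstar b a.
Proof. by move=> ab x y; split=> /ab. Qed.

Lemma Rstar_sym a b : Rstar a b -> Rstar b a.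
Proof. by move=> ab x y; split=> /ab. Qed.

Lemma Dstar_of_Lstar a b : Lstar a b -> Dstar a b.
Proof. by move=> ab Q _ LQ _; apply: LQ. Qed.

Lemma Dstar_of_Rstar a b : Rstar a b -> Dstar a b.
Proof. by move=> ab Q _ _ RQ; apply: RQ. Qed.

Lemma Dstar_equiv : RelationClasses.Equivalence (@Dstar M).
Proof.
split=> [a Q [refl _ _] _ _|a b ab Q eqQ LQ RQ|a b c ab bc Q eqQ LQ RQ].
- exact: refl.
- by case: (eqQ) => _ sym _; apply: sym; apply: ab.
- by case: (eqQ) => _ _ trans; apply: (trans _ b); [apply: ab | apply: bc].
Qed.

Lemma Dstar_trans a b c : Dstar a b -> Dstar b c -> Dstar a c.
Proof. by have [_ _] := Dstar_equiv; apply. Qed.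

Lemma Dstar_sym a b : Dstar a b -> Dstar b a.
Proof. by have [_ + _] := Dstar_equiv; apply. Qed.

Lemma mem_Jstar_ideal a : Jstar_ideal a a.
Proof. exact: (@sub_gen_smallest _ _ [set a]). Qed.

Lemma Jstar_ideal_min a (I : set M) : star_ideal I -> I a -> Jstar_ideal a `<=` I.
Proof. by move=> starI Ia; apply: smallest_sub => // _ ->. Qed.

Lemma star_ideal_Jstar a : star_ideal (Jstar_ideal a).
Proof.
split=> [b x Jb|b c bc Jb|b c bc Jb].
- by split=> I JI; have [[idI _ _] _] := JI; case: (idI b x (Jb I JI)).
- by move=> I JI; have [[_ LI _] _] := JI; apply: LI bc (Jb I JI).
- by move=> I JI; have [[_ _ RI] _] := JI; apply: RI bc (Jb I JI).
Qed.

(** The ideal [Jstar_ideal a] is itself saturated, so it cannot distinguish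
    [a] from an element that is [Lstar]- or [Rstar]-related to it. *)
Lemma Dstar_Jstar a b : Dstar a b -> Jstar a b.
Proof.
have sat (R : M -> M -> Prop) : (forall x y, R x y -> R y x) ->
    (forall x, saturated R (Jstar_ideal x)) ->
    forall x y, R x y -> Jstar x y.
  move=> symR satR x y xy; apply/seteqP.
  by split; apply: Jstar_ideal_min (star_ideal_Jstar _) _;
    [apply: satR (symR _ _ xy) _ | apply: satR xy _]; apply: mem_Jstar_ideal.
move=> ab; apply: (ab (@Jstar M)).
- by split=> [x|x y|x y z]; rewrite /Jstar; [|move->|move->].
- by apply: sat Lstar_sym _ => x; case: (star_ideal_Jstar x).
- by apply: sat Rstar_sym _ => x; case: (star_ideal_Jstar x).
Qed.

End StarredRelations.

(** * Endomorphisms of a semigroup *)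

Section Endomorphisms.
Local Open Scope group_scope.
Variable S : semigroupType.
Implicit Types a b x y : endo S.

Definition endo_of (f : S -> S) (fM : {morph f : s t / s * t}) : endo S :=
  HB.pack f (isMultiplicative.Build S S f fM).

Lemma endo_mulE a b s : (a * b) s = b (a s).
Proof. by []. Qed.

Lemma const_morph (e : S) : e * e = e -> {morph (fun=> e) : s t / s * t : S}.
Proof. by move=> ee s t; rewrite ee. Qed.

Definition const_endo (e : S) (ee : e * e = e) : endo S :=
  endo_of (const_morph ee).

Lemma conj_morph (M : monoidType) (u v : M) : u * v = 1 ->
  {morph (fun s => v * s * u) : s t / s * t}.
Proof. by move=> uv s t; rewrite !mulgA -[_ * u * v]mulgA uv mulg1. Qed.

Lemma autos_cancell a x y : autos S a -> a * x = a * y -> x = y.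
Proof.
case=> b _ bK axy; apply: endoP => s.
by have := congr1 (fun c : endo S => c (b s)) axy; rewrite !endo_mulE bK.
Qed.

Lemma autos_cancelr a x y : autos S a -> x * a = y * a -> x = y.
Proof.
move=> /bij_inj a_inj xya; apply: endoP => s; apply: a_inj.
exact: (congr1 (fun c : endo S => c s) xya).
Qed.

Lemma eq_ker_Rstar a b :
  (forall s t, a s = a t <-> b s = b t) -> Rstar a b.
Proof.
move=> kerab x y; split=> xy; apply: endoP => s; apply/kerab;
  exact: (congr1 (fun c : endo S => c s) xy).
Qed.

Definition constant_endo a : Prop := exists e, forall s, a s = e.

(** The constant value [e] is idempotent, so [const_endo e] is an
    endomorphism, and [a * 1 = a * const_endo e]. *)
Lemma Lstar_constant a b : constant_endo a -> Lstar a b -> constant_endo b.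
Proof.
move=> [e ae] ab.
have ee : e * e = e by rewrite -[in LHS](ae e) -{2}(ae e) -gmulfM ae.
have /ab/(congr1 (fun c : endo S => c _)) be : a * 1 = a * const_endo ee.
  by apply: endoP => s; rewrite !endo_mulE ae.
by exists e => s; rewrite -[RHS]/((b * const_endo ee) s) -be.
Qed.

(** As for [Lstar_constant], now from [1 * a = const_endo e * a]. *)
Lemma Rstar_constant a b : constant_endo a -> Rstar a b -> constant_endo b.
Proof.
move=> [e ae] ab.
have ee : e * e = e by rewrite -[in LHS](ae e) -{2}(ae e) -gmulfM ae.
have /ab/(congr1 (fun c : endo S => c _)) be : 1 * a = const_endo ee * a.
  by apply: endoP => s; rewrite !endo_mulE !ae.
by exists (b e) => s; rewrite -[LHS]/((1 * b) s) be.
Qed.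

Lemma constant_ideal : ideal constant_endo.
Proof.
move=> a x [e ae]; split; first by exists e => s; rewrite endo_mulE ae.
by exists (x e) => s; rewrite endo_mulE ae.
Qed.

End Endomorphisms.

(** * Transformations *)

Lemma exists_notin (T : finType) (r : seq T) :
  (size r < #|T|)%N -> exists x, x \notin r.
Proof.
move=> r_lt; apply/existsP; rewrite -[X in is_true X]negbK negb_exists.
apply/negP=> /forallP all_r; have := card_size r; rewrite leqNgt => /negP[].
by rewrite (eq_card (B := T)) // => x; rewrite (negbNE (all_r x)).
Qed.

Section Transformations.
Local Open Scope group_scope.
Variable n : nat.
Implicit Types (s t e u : transf n) (p q : 'S_n) (i j k : 'I_n).

Lemma transfM s t i : (s * t) i = t (s i).
Proof. by rewrite ffunE. Qed.

Lemma transf1 i : (1 : transf n) i = i.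
Proof. by rewrite ffunE. Qed.

Definition of_perm p : transf n := [ffun i => p i].

Lemma of_permE p i : of_perm p i = p i.
Proof. by rewrite ffunE. Qed.

Lemma of_permM p q : of_perm (p * q) = of_perm p * of_perm q.
Proof. by apply/ffunP=> i; rewrite !ffunE permM. Qed.

Lemma of_perm1 : of_perm 1 = 1.
Proof. by apply/ffunP=> i; rewrite !ffunE perm1. Qed.

Definition cst i : transf n := [ffun=> i].

Lemma cstE i j : cst i j = i.
Proof. by rewrite ffunE. Qed.

Lemma cst_mul i s : cst i * s = cst (s i).
Proof. by apply/ffunP=> j; rewrite !ffunE. Qed.

Lemma mul_cst s i : s * cst i = cst i.
Proof. by apply/ffunP=> j; rewrite !ffunE. Qed.

Lemma cst_inj i j : cst i = cst j -> i = j.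
Proof. by move=> /ffunP/(_ i); rewrite !ffunE. Qed.

Variant transf_spec s : Prop :=
  | TransfPerm p of s = of_perm p
  | TransfSing i j of i != j & s i = s j.

Lemma transfP s : transf_spec s.
Proof.
have [/injectiveP s_inj|/injectivePn[i [j ij sij]]] := boolP (injectiveb s).
  by apply: (@TransfPerm s (perm s_inj)); apply/ffunP=> i; rewrite ffunE permE.
exact: TransfSing ij sij.
Qed.

Lemma phi_perm t e p : phi t e (of_perm p) = if odd_perm p then t else t * t.
Proof.
rewrite /phi; have -> : insub (of_perm p : {ffun _}) = Some p => //.
rewrite -[RHS]valK; congr insub; apply/ffunP=> i.
by rewrite ffunE -pvalE.
Qed.

Lemma phi_sing t e s i j : i != j -> s i = s j -> phi t e s = e.
Proof.
move=> ij sij; rewrite /phi insubN //; apply/injectivePn.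
by exists i; exists j.
Qed.

(** The admissible parameters in the Schein-Teclezghi classification of the
    endomorphisms of [T_n]. *)
Definition phi_pair t e : Prop :=
  [/\ t * t * t = t, t * e = e, e * t = e & e * e = e].

Lemma phi_morph t e : phi_pair t e -> {morph phi t e : s s' / s * s'}.
Proof.
move=> [ttt te et ee] s s'.
case: (transfP s) => [p ->|i j ij sij]; last first.
  rewrite (phi_sing t e ij sij) (phi_sing t e ij); last by rewrite !transfM sij.
  case: (transfP s') => [q ->|k l kl skl]; last by rewrite (phi_sing t e kl skl).
  by rewrite phi_perm; case: ifP; rewrite ?mulgA !et.
case: (transfP s') => [q ->|k l kl skl]; last first.
  rewrite (phi_sing t e kl skl) (@phi_sing _ _ _ (p^-1 k) (p^-1 l)).
  - by rewrite phi_perm; case: ifP; rewrite -?mulgA !te.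
  - by rewrite (inj_eq perm_inj).
  - by rewrite !transfM !of_permE !permKV.
rewrite -of_permM !phi_perm odd_permM.
by case: odd_perm; case: odd_perm; rewrite //= ?mulgA !ttt.
Qed.

Definition phi_endo t e (te : phi_pair t e) : endo (transf n) :=
  endo_of (phi_morph te).

End Transformations.

(** * Endomorphisms that are not automorphisms *)

Section Kernel.
Local Open Scope group_scope.
Variables (n : nat) (n_gt4 : (4 < n)%N).
Implicit Types (s t e : transf n) (p q : 'S_n) (i j k : 'I_n).

(** If [p] moves [i], then [p] does not commute with the transposition of [p i]
    with a third point, which fixes [i] but not [p i]. *)
Lemma center_Sym p : (forall q, commute p q) -> p = 1.
Proof.
move=> pC; apply/permP=> i; rewrite perm1; apply/eqP/negPn/negP=> pi_i.
have [|k] := @exists_notin _ [:: i; p i];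
  first by rewrite card_ord (leq_trans _ n_gt4).
rewrite !inE negb_or => /andP[k_i k_pi].
have /permP/(_ i) := pC (tperm (p i) k); rewrite !permM tpermL.
rewrite tpermD // => pi_k.
by rewrite pi_k eqxx in k_pi.
Qed.

(** By simplicity, [N] could only fail to contain the alternating group by
    meeting it trivially; then the commutators of elements of [N], which lie in
    both subgroups, are trivial, and [N] is central. *)
Lemma Alt_sub_normal (N : {group 'S_n}) :
  N <| [set: 'S_n] -> N != 1%G -> 'Alt_'I_n \subset N.
Proof.
move=> nN N_n1.
have altS : simple 'Alt_'I_n by apply: simple_Alt5; rewrite card_ord.
have nAN : (N :&: 'Alt_'I_n)%G <| 'Alt_'I_n.
  apply: normalS (subsetIr _ _) _ (normalI nN (Alt_normal _)).
  exact: Alt_subset.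
have [_ /(_ _ nAN)[NA1|NA]] := simpleP _ altS; last first.
  by apply/finset.setIidPr; apply: NA.
case/trivgPn: N_n1 => p Np; case/eqP; apply: center_Sym => q.
have : [~ p, q] \in N :&: 'Alt_'I_n.
  rewrite inE Alt_even commgEl odd_permM odd_permV odd_permJ addbb andbT.
  by rewrite groupM ?groupV // memJ_norm // (fintype.subsetP (normal_norm nN)) ?inE.
by rewrite [_ :&: _]NA1 => /set1P/eqP/commgP.
Qed.

Variable a : endo (transf n).

(** The permutations that [a] identifies with [1] form a normal subgroup. *)
Lemma even_collapse p q : p != q -> a (of_perm p) = a (of_perm q) ->
  forall r : 'S_n, ~~ odd_perm r -> a (of_perm r) = a 1.
Proof.
move=> p_q apq.
pose N : {set 'S_n} := [set r | a (of_perm r) == a 1].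
have gN : group_set N.
  apply/group_setP; split=> [|x y]; rewrite !inE ?of_perm1 //.
  by move=> /eqP ax /eqP ay; rewrite of_permM gmulfM ax ay -gmulfM mulg1.
have nN : Group gN <| [set: 'S_n].
  apply/andP; split; first exact: finset.subsetT.
  apply/fintype.subsetP=> x _; rewrite inE; apply/fintype.subsetP=> _ /imsetP[y Ny ->].
  rewrite inE in Ny; rewrite inE conjgE !of_permM !gmulfM (eqP Ny) -!gmulfM.
  by rewrite mul1g -of_permM mulVg of_perm1.
have N_n1 : Group gN != 1%G.
  apply/trivgPn; exists (p * q^-1); last by rewrite -eq_mulgV1.
  by rewrite inE of_permM gmulfM apq -gmulfM -of_permM mulgV of_perm1.
move=> r r_even; have /fintype.subsetP/(_ r) := Alt_sub_normal nN N_n1.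
by rewrite Alt_even inE => /(_ r_even)/eqP.
Qed.

Hypothesis a_even : forall r : 'S_n, ~~ odd_perm r -> a (of_perm r) = a 1.

(** A 3-cycle is even and carries [i] to [j]. *)
Lemma cst_collapse i j : a (cst i) = a (cst j).
Proof.
have [->//|ij] := eqVneq i j.
have [|k] := @exists_notin _ [:: i; j].
  by rewrite card_ord (leq_trans _ n_gt4).
rewrite !inE negb_or => /andP[ki kj].
pose r := tperm i k * tperm k j.
have <- : cst i * of_perm r = cst j.
  by rewrite cst_mul of_permE permM !tpermL.
rewrite gmulfM a_even -?gmulfM ?mulg1 //.
by rewrite odd_mul_tperm odd_tperm eq_sym ki kj.
Qed.

Definition merge i j : transf n := [ffun k => if k == i then j else k].

(** Conjugation by a 3-cycle that carries [i] to [i'] and fixes [j]; the fourth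
    point [k] is what makes such a cycle available. *)
Lemma merge_collapse i i' j : i != j -> i' != j ->
  a (merge i j) = a (merge i' j).
Proof.
move=> i_j i'_j; have [->//|i_i'] := eqVneq i i'.
have [|k] := @exists_notin _ [:: i; i'; j].
  by rewrite card_ord (leq_trans _ n_gt4).
rewrite !inE !negb_or => /and3P[k_i k_i' k_j].
pose r := tperm i k * tperm k i'.
have r_even : ~~ odd_perm r by rewrite odd_mul_tperm odd_tperm eq_sym k_i k_i'.
have ri : r i = i' by rewrite permM !tpermL.
have rj : r j = j by rewrite permM !tpermD.
have <- : of_perm r^-1 * merge i j * of_perm r = merge i' j.
  apply/ffunP=> m; rewrite !transfM !of_permE !ffunE -[m](permKV r) permK.
  rewrite -[in RHS]ri (inj_eq perm_inj).
  by case: ifP => //= _; rewrite rj.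
by rewrite !gmulfM !a_even ?odd_permV // -!gmulfM mul1g mulg1.
Qed.

(** Merging all points into [j] one after the other gives [cst j], while [a]
    sends each factor of this product to the same idempotent. *)
Lemma merge_cst i j : i != j -> a (merge i j) = a (cst j).
Proof.
move=> i_j; pose m (r : seq 'I_n) := foldr (fun k s => merge k j * s) 1 r.
have mE r k : m r k = if k \in r then j else k.
  elim: r k => [|l r IH] k; first by rewrite transf1.
  rewrite /= transfM IH ffunE inE; case: (k == l) => //=.
  by case: ifP.
have am r : all (predC1 j) r -> r != [::] -> a (m r) = a (merge i j).
  elim: r => // k r IH /= /andP[k_j r_j] _.
  have [->|r_n0] := eqVneq r [::]; first by rewrite /= mulg1; apply: merge_collapse.
  rewrite gmulfM (IH r_j r_n0) (merge_collapse k_j i_j) -gmulfM.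
  congr (a _); apply/ffunP=> l; rewrite transfM !ffunE.
  by case: (eqVneq l i) => [_|/negbTE->//]; rewrite eq_sym (negbTE i_j).
rewrite -(am (rem j (enum 'I_n))); first last.
- rewrite rem_filter ?enum_uniq // -has_filter; apply/hasP.
  by exists i; rewrite ?mem_enum.
- by rewrite rem_filter ?enum_uniq // filter_all.
congr (a _); apply/ffunP=> k; rewrite mE cstE.
by rewrite mem_rem_uniq ?enum_uniq // inE mem_enum andbT; case: eqVneq.
Qed.

(** A singular [s] is left unchanged when [i] and [j], which it identifies, are
    first merged, and [merge i j] acts under [a] like a constant. *)
Lemma sing_collapse s i j k : i != j -> s i = s j -> a s = a (cst k).
Proof.
move=> i_j sij.
have -> : s = merge i j * s.
  by apply/ffunP=> l; rewrite transfM ffunE; case: eqVneq => [->|].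
by rewrite gmulfM merge_cst // -gmulfM cst_mul; apply: cst_collapse.
Qed.

End Kernel.

Section Classification.
Local Open Scope group_scope.
Variables (n : nat) (n_gt4 : (4 < n)%N).
Implicit Types (s t e : transf n) (p q : 'S_n) (i j k : 'I_n).

(** The image of the symmetric group is a group with identity [e = a 1], which
    acts faithfully by permutations on the image of [e].  A common fixed point [w]
    would lie in this image, so the symmetric group would embed in the
    stabiliser of [w], against its order. *)
Lemma group_no_fixpoint (a : endo (transf n)) :
  injective (a \o @of_perm n) -> forall w, exists p, a (of_perm p) w != w.
Proof.
move=> a_inj w; apply/existsP; rewrite -[X in is_true X]negbK negb_exists.
apply/negP=> /forallP a_w.
pose f p := a (of_perm p); pose e := f 1.
have fM p q : f (p * q) = f p * f q by rewrite /f of_permM gmulfM.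
have ef p i : e (f p i) = f p i by rewrite -transfM -fM mulg1.
have fe p i : f p (e i) = f p i by rewrite -transfM -fM mul1g.
have fVK p i : f p^-1 (f p i) = e i by rewrite -transfM -fM mulgV.
(* The image of [e] is its set of fixed points; extend by the identity. *)
pose b p i := if e i == i then f p i else i.
have b_inj p : injective (b p).
  move=> i j; rewrite /b; case: eqP => ei; case: eqP => ej //.
  - by move=> /(congr1 (f p^-1)); rewrite !fVK ei ej.
  - by move=> fpj; case: ej; rewrite -fpj ef.
  - by move=> fpj; case: ei; rewrite fpj ef.
pose B p : 'S_n := perm (b_inj p).
have B_inj : injective B.
  move=> p q /permP Bpq; apply: a_inj; apply/ffunP=> i.
  rewrite -[LHS](fe p) -[RHS](fe q).
  by have := Bpq (e i); rewrite !permE /b ef eqxx.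
have ew : e w = w by apply/eqP; rewrite -[_ == _]negbK a_w.
have Bw p : B p w = w by rewrite permE /b ew eqxx; apply/eqP; rewrite -[_ == _]negbK a_w.
have [|k] := @exists_notin _ [:: w];
  first by rewrite card_ord (leq_trans _ n_gt4).
rewrite inE => /eqP; case.
by rewrite -(Bw (invF B_inj (tperm w k))) f_invF tpermL.
Qed.

(** If two constants were identified, all would be, and every [a (of_perm p)]
    would fix each point of the image of their common value.  Injectivity on
    constants suffices, because [s] is recovered from the products
    [cst i * s]. *)
Lemma injective_on_perms_bij (a : endo (transf n)) :
  injective (a \o @of_perm n) -> bijective a.
Proof.
move=> a_inj.
suff cst_neq i j : i != j -> a (cst i) <> a (cst j).
  apply: injF_bij => s t ast; apply/ffunP=> i; apply/eqP/negPn/negP=> sti.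
  by apply: (cst_neq _ _ sti); rewrite -!cst_mul !gmulfM ast.
move=> ij aij.
have all_eq k l : a (cst k) = a (cst l).
  pose s : transf n := [ffun m => if m == i then k else l].
  have -> : cst k = cst i * s by rewrite cst_mul ffunE eqxx.
  have -> : cst l = cst j * s by rewrite cst_mul ffunE eq_sym (negbTE ij).
  by rewrite !gmulfM aij.
have [p /eqP] := group_no_fixpoint a_inj (a (cst i) i); apply.
by rewrite -transfM -gmulfM cst_mul (all_eq _ i).
Qed.

(** The nontrivial half of the classification of endomorphisms for [n >= 5].
    The values on a transposition and on a constant provide [t] and [e]. *)
Lemma not_auto_phi (a : endo (transf n)) : ~ autos (transf n) a ->
  exists t e, phi_pair t e /\ (a : transf n -> transf n) = phi t e.
Proof.
move=> a_nbij; have [a_inj|] := boolP (injectiveb (a \o @of_perm n)).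
  by case: a_nbij; apply: injective_on_perms_bij; apply/injectiveP.
case/injectivePn=> p [q p_q /= apq].
have a_even := even_collapse n_gt4 p_q apq.
have [|i _] := @exists_notin 'I_n [::];
  first by rewrite card_ord (leq_trans _ n_gt4).
have [|j] := @exists_notin _ [:: i];
  first by rewrite card_ord (leq_trans _ n_gt4).
rewrite inE eq_sym => ij; pose r := tperm i j.
have r_odd : odd_perm r by rewrite odd_tperm.
pose t := a (of_perm r); pose e := a (cst i).
have tt : t * t = a 1 by rewrite -gmulfM -of_permM tperm2 of_perm1.
have t1 : a 1 * t = t by rewrite -gmulfM mul1g.
exists t, e; split.
  split; first by rewrite tt.
  - by rewrite -gmulfM mul_cst.
  - by rewrite -gmulfM cst_mul; apply: cst_collapse.
  - by rewrite -gmulfM mul_cst.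
apply/funext=> s; case: (transfP s) => [x ->|k l kl skl]; last first.
  by rewrite (phi_sing _ _ kl skl); apply: sing_collapse kl skl.
rewrite phi_perm tt; case: ifP => [x_odd|/negbT x_even]; last exact: a_even.
have -> : x = x * r^-1 * r by rewrite mulgKV.
rewrite of_permM gmulfM a_even ?odd_permM ?odd_permV ?x_odd ?r_odd //.
Qed.

End Classification.

(** * The three classes *)

Section Automorphisms.
Local Open Scope group_scope.
Variable n : nat.

(** Every automorphism is inner: constant maps are the right zeros, so they are
    permuted, and this permutation [p] of the points conjugates [s] to [a s]. *)
Lemma auto_conj (a : endo (transf n)) : autos (transf n) a ->
  exists p : 'S_n, forall s i, a s (p i) = p (s i).
Proof.
move=> a_bij; have a_inj := bij_inj a_bij; case: (a_bij) => a' aK a'K.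
have a_cst i : a (cst i) = cst (a (cst i) i).
  (* [a (cst i)] is again a right zero, hence constant. *)
  have rzero s : s * a (cst i) = a (cst i) by rewrite -[s]a'K -gmulfM mul_cst.
  by rewrite -[LHS](rzero (cst i)) cst_mul.
have g_inj : injective (fun i => a (cst i) i).
  by move=> i j gij; apply: cst_inj; apply: a_inj; rewrite a_cst gij -a_cst.
exists (perm g_inj) => s i; rewrite !permE; apply: cst_inj.
by rewrite -cst_mul -a_cst -gmulfM cst_mul -a_cst.
Qed.

End Automorphisms.

Section PhiEndomorphisms.
Local Open Scope group_scope.
Variables (n : nat) (n_gt4 : (4 < n)%N).
Implicit Types (s t e u : transf n) (p q r : 'S_n) (i j k : 'I_n).
Implicit Types a b c d : endo (transf n).

Lemma distinct_points : exists i j k, [/\ i != j, i != k & j != k].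
Proof.
have [|i _] := @exists_notin 'I_n [::];
  first by rewrite card_ord (leq_trans _ n_gt4).
have [|j] := @exists_notin _ [:: i];
  first by rewrite card_ord (leq_trans _ n_gt4).
have [|k] := @exists_notin _ [:: i; j];
  first by rewrite card_ord (leq_trans _ n_gt4).
rewrite !inE negb_or => /andP[ki kj] ji.
by exists i, j, k; split; rewrite eq_sym.
Qed.

Lemma phi_surj_t t e : exists s, phi t e s = t.
Proof.
have [i [j [_ [ij _ _]]]] := distinct_points.
by exists (of_perm (tperm i j)); rewrite phi_perm odd_tperm ij.
Qed.

Lemma phi_surj_e t e : exists s, phi t e s = e.
Proof.
have [i [j [_ [ij _ _]]]] := distinct_points.
by exists (cst i); rewrite (phi_sing t e ij) // !cstE.
Qed.

Lemma phi_image t e s :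
  [\/ phi t e s = t, phi t e s = t * t | phi t e s = e].
Proof.
case: (transfP s) => [p ->|i j ij sij]; last first.
  by rewrite (phi_sing t e ij sij); constructor 3.
by rewrite phi_perm; case: ifP => _; [constructor 1 | constructor 2].
Qed.

(** The image of [phi t e] is generated by [t] and [e]. *)
Lemma phi_mul_eq b c d t e : (b : transf n -> transf n) = phi t e ->
  b * c = b * d <-> c t = d t /\ c e = d e.
Proof.
move=> bE; split=> [bcd|[ct ce]]; last first.
  apply: endoP => s; rewrite !endo_mulE bE.
  by case: (phi_image t e s) => ->; rewrite ?gmulfM ?ct.
have cd s : c (phi t e s) = d (phi t e s).
  by rewrite -bE; apply: (congr1 (fun x : endo _ => x s) bcd).
have [s ts] := phi_surj_t t e; have [s' es'] := phi_surj_e t e.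
by split; [rewrite -ts | rewrite -es'].
Qed.

Lemma phi_pair_sq t e : phi_pair t e -> phi_pair (t * t) e.
Proof.
move=> [ttt te et ee]; have uu : t * t * (t * t) = t * t by rewrite mulgA ttt.
by split; rewrite ?uu // ?mulgA ?et // -mulgA !te.
Qed.

Lemma phi_pair_sq_neq t e : phi_pair t e -> t != e -> t * t != e.
Proof.
by move=> [ttt te et ee] t_e; apply: contra_neq t_e => tte; rewrite -ttt tte.
Qed.

Lemma phi_eq_ker t e t' e' s s' :
  phi_pair t e -> phi_pair t' e' -> t != e -> t' != e' ->
  (t * t = t -> t' * t' = t') -> phi t e s = phi t e s' -> phi t' e' s = phi t' e' s'.
Proof.
move=> te te' t_e t'_e' idem.
have /eqP tt_e := phi_pair_sq_neq te t_e.
have /eqP tt_e' := phi_pair_sq_neq te' t'_e'.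
move/eqP: t_e => t_e; move/eqP: t'_e' => t'_e'.
case: (transfP s) => [p ->|i j ij sij]; case: (transfP s') => [q ->|k l kl skl];
  rewrite ?(phi_sing _ _ ij sij) ?(phi_sing _ _ kl skl) ?phi_perm //;
  do ?case: ifP => _; move=> // eq_te;
  by [apply: idem | apply/esym/idem | case: t_e | case: tt_e].
Qed.

Lemma phi_Rstar a b t e t' e' : phi_pair t e -> phi_pair t' e' ->
  (a : transf n -> transf n) = phi t e -> (b : transf n -> transf n) = phi t' e' ->
  t != e -> t' != e' -> (t * t = t <-> t' * t' = t') -> Rstar a b.
Proof.
move=> te te' aE bE t_e t'_e' [idem idem']; apply: eq_ker_Rstar => s s'.
by rewrite aE bE; split; apply: phi_eq_ker.
Qed.

Lemma E1_constant a : E1 n a <-> constant_endo a.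
Proof.
rewrite E1_image_singleton; last by rewrite (leq_trans _ n_gt4).
split=> [[e ae]|[e ae]]; exists e.
  by move=> s; have : range a (a s) by [exists s]; rewrite ae.
by apply/seteqP; split=> [_ [s _ <-]|_ ->] //=; exists 1.
Qed.

End PhiEndomorphisms.

Section Flip.
Local Open Scope group_scope.
Variables (n : nat) (n_gt4 : (4 < n)%N).
Variables (x y z : 'I_n).
Hypotheses (xy : x != y) (xz : x != z) (yz : y != z).
Implicit Types (s t e u : transf n) (p q r : 'S_n) (i j k : 'I_n).
Implicit Types a b c d : endo (transf n).

(** A singular map that is not idempotent but has the same centraliser among
    the permutations fixing [x] as its square. *)
Definition flip : transf n :=
  [ffun k => if k == y then z else if k == z then y else x].

Let flipy : flip y = z. Proof. by rewrite ffunE eqxx. Qed.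
Let flipz : flip z = y. Proof. by rewrite ffunE eq_sym (negbTE yz) eqxx. Qed.
Let flipx k : k != y -> k != z -> flip k = x.
Proof. by rewrite ffunE => /negbTE-> /negbTE->. Qed.

Lemma flip_pair : phi_pair flip (cst x).
Proof.
split; rewrite ?mul_cst ?cst_mul ?cstE ?flipx //.
apply/ffunP=> k; rewrite !transfM.
have [->|ky] := eqVneq k y; first by rewrite flipy flipz flipy.
have [->|kz] := eqVneq k z; first by rewrite flipz flipy flipz.
by rewrite (flipx ky kz) !flipx.
Qed.

Lemma flip_not_idem : flip * flip <> flip.
Proof.
by move=> /ffunP/(_ y); rewrite transfM flipy flipz => /eqP; rewrite (negbTE yz).
Qed.

Lemma flip_neq : flip != cst x.
Proof.
by apply/eqP => /ffunP/(_ y); rewrite flipy cstE => /eqP; rewrite eq_sym (negbTE xz).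
Qed.

(** The points other than [x] fixed by [flip * flip] are [y] and [z], so [r]
    either fixes both or swaps them. *)
Lemma flip_comm r : r x = x ->
  (forall i, (flip * flip) (r i) = r ((flip * flip) i)) ->
  forall i, flip (r i) = r (flip i).
Proof.
move=> rx rC.
have ryz i : i != x -> (flip * flip) i = i -> r i = y \/ r i = z.
  move=> ix fi; have := rC i; rewrite fi transfM.
  have [|ky] := eqVneq (r i) y; first by left.
  have [|kz] := eqVneq (r i) z; first by right.
  by rewrite !flipx // -[X in X = _]rx => /perm_inj xi; rewrite xi eqxx in ix.
have [ry rz] : (r y = y \/ r y = z) /\ (r z = y \/ r z = z).
  split; apply: ryz; rewrite 1?eq_sym // transfM ?flipy ?flipz ?flipy //.
have yzr : r y != r z by rewrite (inj_eq perm_inj).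
have {ry rz}[[ry rz]|[ry rz]] : (r y = y /\ r z = z) \/ (r y = z /\ r z = y).
  by case: ry rz yzr => -> [] ->; rewrite ?eqxx //; [left | right].
all: move=> i; have [->|iy] := eqVneq i y; first by rewrite ?ry ?flipy ?flipz ?rz.
all: have [->|iz] := eqVneq i z; first by rewrite ?rz ?flipy ?flipz ?ry.
all: rewrite (flipx iy iz) rx flipx //.
all: by rewrite -1?[X in _ != X]ry -1?[X in _ != X]rz (inj_eq perm_inj).
Qed.

(** An endomorphism other than an automorphism takes the same value on the
    singular maps [flip], [flip * flip] and [cst x], while an automorphism
    separates them.  For two automorphisms, [flip_comm] applies to the quotient of the
    permutations that induce them. *)
Lemma flip_Lstar a b : (a : transf n -> transf n) = phi flip (cst x) ->
  (b : transf n -> transf n) = phi (flip * flip) (cst x) -> Lstar a b.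
Proof.
move=> aE bE c d.
rewrite (phi_mul_eq n_gt4 _ _ aE) (phi_mul_eq n_gt4 _ _ bE).
split=> [[cf cx]|[cff cx]]; first by rewrite !gmulfM cf.
split=> //.
have sing_phi f : ~ autos (transf n) f -> f flip = f (cst x) /\ f (flip * flip) = f (cst x).
  case/(not_auto_phi n_gt4)=> t [e [_ ->]].
  have [|k] := @exists_notin _ [:: x; y; z];
  first by rewrite card_ord (leq_trans _ n_gt4).
  rewrite !inE !negb_or => /and3P[kx ky kz].
  split; rewrite (phi_sing _ _ kx) ?(phi_sing _ _ kx) ?cstE //.
    by rewrite !flipx.
  by rewrite !transfM !flipx.
have ff_x : flip * flip != cst x := phi_pair_sq_neq flip_pair flip_neq.
have [c_auto|c_sing] := pselect (autos (transf n) c);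
  have [d_auto|d_sing] := pselect (autos (transf n) d).
- have [p pE] := auto_conj c_auto; have [q qE] := auto_conj d_auto.
  pose r := p * q^-1.
  have rE i s : c s = d s -> r (s i) = s (r i).
    move=> cds; apply: (@perm_inj _ q); rewrite !permM permKV -pE -qE permKV.
    by rewrite cds.
  have pr i : p i = q (r i) by rewrite permM permKV.
  apply/ffunP=> j; rewrite -[j](permKV p) pE !pr qE; congr (q _); apply/esym.
  apply: flip_comm => // [|i]; last by rewrite -rE.
  by have := rE x (cst x) cx; rewrite !cstE.
- have [df dff] := sing_phi _ d_sing; case/eqP: ff_x; apply: (bij_inj c_auto).
  by rewrite cff dff cx.
- have [cf cff'] := sing_phi _ c_sing; case/eqP: ff_x; apply: (bij_inj d_auto).
  by rewrite -cff cff' cx.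
- by have [-> _] := sing_phi _ d_sing; have [-> _] := sing_phi _ c_sing.
Qed.

End Flip.

Section StarClasses.
Local Open Scope group_scope.
Variables (n : nat) (n_gt4 : (4 < n)%N).
Implicit Types (s t e u : transf n) (p q r : 'S_n) (i j k : 'I_n).
Implicit Types a b c d : endo (transf n).

(** [phi t e] is not right cancellable: the constant endomorphisms at two
    different constant maps become equal when followed by it. *)
Lemma Rstar_autos a b : autos _ a -> Rstar a b -> autos _ b.
Proof.
move=> a_auto ab; apply: contrapT => /(not_auto_phi n_gt4)[t [e [_ bE]]].
have [i [j [_ [ij _ _]]]] := distinct_points n_gt4.
have cc k : cst k * cst k = cst k by rewrite mul_cst.
have /ab/(autos_cancelr a_auto) cij : const_endo (cc i) * b = const_endo (cc j) * b.
  apply: endoP => s; rewrite !endo_mulE bE.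
  by rewrite !(phi_sing _ _ ij) // !cstE.
have := congr1 (fun c : endo _ => c 1) cij.
by move=> /cst_inj /eqP; rewrite (negbTE ij).
Qed.

(** [phi t e] is not left cancellable.  If [t] is an odd permutation, then [t]
    is an involution commuting with the whole image, and conjugation by it is a
    nontrivial automorphism fixing that image.  Otherwise the image has no odd
    permutation, and the two endomorphisms obtained from [flip] agree on it. *)
Lemma Lstar_autos a b : autos _ a -> Lstar a b -> autos _ b.
Proof.
move=> a_auto ab; apply: contrapT => /(not_auto_phi n_gt4)[t [e [te bE]]].
have cancel c d : c t = d t -> c e = d e -> c = d.
  move=> ct ce; apply: (autos_cancell a_auto); apply/ab.
  by apply/(phi_mul_eq n_gt4 _ _ bE).
have [ttt tee et ee] := te.
have [i [j [k [ij ik jk]]]] := distinct_points n_gt4.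
have fp := flip_pair ij ik jk.
have phi_sq u : (forall p, u = of_perm p -> ~~ odd_perm p) ->
    phi_endo fp u = phi_endo (phi_pair_sq fp) u.
  rewrite /=; case: (transfP u) => [p -> /(_ p erefl) p_even|l m lm ulm _].
    by rewrite !phi_perm (negbTE p_even) mulgA; case: fp => ->.
  by rewrite !(phi_sing _ _ lm ulm).
have e_even p : e = of_perm p -> ~~ odd_perm p.
  move=> ep; suff -> : p = 1 by rewrite odd_perm1.
  apply/permP=> l; rewrite perm1; apply: (@perm_inj _ p).
  by have /ffunP/(_ l) := ee; rewrite ep transfM !of_permE.
have [[p tp p_odd]|t_even] := pselect (exists2 p, t = of_perm p & odd_perm p).
  have tt1 : t * t = 1.
    rewrite -[LHS]mulg1 -of_perm1 -(mulgV p) of_permM -tp mulgA ttt tp.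
    by rewrite -of_permM mulgV.
  have /(congr1 (fun c : endo _ => c _)) tC : endo_of (conj_morph tt1) = 1.
    by apply: cancel; rewrite /= ?ttt // tee et.
  suff p1 : p = 1 by rewrite p1 odd_perm1 in p_odd.
  apply/permP=> l; rewrite perm1 -of_permE -tp; apply: cst_inj.
  by rewrite -cst_mul -{1}(mul_cst t l); apply: tC.
have /(congr1 (fun c : endo _ => c (of_perm (tperm i j)))) : phi_endo fp = phi_endo (phi_pair_sq fp).
  apply: cancel; apply: phi_sq => // p tp; apply/negP=> p_odd.
  by apply: t_even; exists p.
rewrite /= !phi_perm odd_tperm ij => /esym; exact: (flip_not_idem (x := i) jk).
Qed.

Definition same_class a b : Prop :=
  (autos _ a <-> autos _ b) /\ (constant_endo a <-> constant_endo b).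

Lemma Dstar_same_class a b : Dstar a b -> same_class a b.
Proof.
move=> ab; apply: (ab same_class); rewrite /same_class.
- split=> [c|c d|c d f]; tauto.
- move=> c d cd; have dc := Lstar_sym cd.
  by split; split=> ?;
    [apply: Lstar_autos cd | apply: Lstar_autos dc
    | apply: Lstar_constant cd | apply: Lstar_constant dc].
- move=> c d cd; have dc := Rstar_sym cd.
  by split; split=> ?;
    [apply: Rstar_autos cd | apply: Rstar_autos dc
    | apply: Rstar_constant cd | apply: Rstar_constant dc].
Qed.

Lemma autos_Lstar a b : autos _ a -> autos _ b -> Lstar a b.
Proof.
by move=> a_auto b_auto c d; split=> [/(autos_cancell a_auto)|/(autos_cancell b_auto)] ->.
Qed.

Lemma constant_Rstar a b : constant_endo a -> constant_endo b -> Rstar a b.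
Proof. by move=> [e ae] [f bf]; apply: eq_ker_Rstar => s t; rewrite !ae !bf. Qed.

(** By kernels, [a] is [Rstar]-related to one of the two endomorphisms that
    [flip_Lstar] links. *)
Lemma Dstar_flip a x y z (xy : x != y) (xz : x != z) (yz : y != z) :
  ~ autos _ a -> ~ constant_endo a -> Dstar a (phi_endo (flip_pair xy xz yz)).
Proof.
move=> /(not_auto_phi n_gt4)[t [e [te aE]]] a_nconst.
have t_e : t != e.
  apply/eqP=> t_e; apply: a_nconst; exists e => s; rewrite aE -t_e phi_idem // t_e.
  by case: te.
set fp := flip_pair xy xz yz; have fe := flip_neq y xz.
pose b := phi_endo (phi_pair_sq fp).
have [tt|tt] := pselect (t * t = t); last first.
  apply: Dstar_of_Rstar; apply: (phi_Rstar te fp aE) => //.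
  by split=> [//|/(flip_not_idem yz)].
have ab : Rstar a b.
  apply: (phi_Rstar te (phi_pair_sq fp) aE) => //; first exact: phi_pair_sq_neq.
  by split=> // _; rewrite mulgA; case: (fp) => ->.
apply: Dstar_trans (Dstar_of_Rstar ab) _; apply: Dstar_of_Lstar; apply: Lstar_sym.
exact: (flip_Lstar n_gt4 xy xz yz).
Qed.

Lemma Dstar_iff a b : Dstar a b <-> same_class a b.
Proof.
split; first exact: Dstar_same_class.
case=> ab_auto ab_const.
have [a_auto|a_nauto] := pselect (autos _ a).
  by apply: Dstar_of_Lstar; apply: autos_Lstar => //; apply/ab_auto.
have [a_const|a_nconst] := pselect (constant_endo a).
  by apply: Dstar_of_Rstar; apply: constant_Rstar => //; apply/ab_const.
have [x [y [z [xy xz yz]]]] := distinct_points n_gt4.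
apply: Dstar_trans (Dstar_flip xy xz yz a_nauto a_nconst) _.
by apply: Dstar_sym; apply: Dstar_flip; [move/ab_auto | move/ab_const].
Qed.

Lemma constant_star_ideal : star_ideal (@constant_endo (transf n)).
Proof.
split; first exact: constant_ideal.
- by move=> a b ab a_const; apply: Lstar_constant ab.
- by move=> a b ab a_const; apply: Rstar_constant ab.
Qed.

(** As [T_n] is finite, a factor of an automorphism is an automorphism. *)
Lemma not_autos_star_ideal : star_ideal (fun a => ~ autos (transf n) a).
Proof.
split=> [a c a_nauto|a b ab a_nauto b_auto|a b ab a_nauto b_auto].
- split=> ca_bij; apply: a_nauto; apply: injF_bij.
  + have c_inj : injective c := inj_compr (bij_inj ca_bij).
    have [c' _ c'K] := injF_bij c_inj.
    move=> s s' ass'; rewrite -[s]c'K -[s']c'K; congr (c _).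
    by apply: (bij_inj ca_bij); rewrite !endo_mulE !c'K.
  + exact: inj_compr (bij_inj ca_bij).
- by apply/a_nauto/(Lstar_autos b_auto)/Lstar_sym.
- by apply/a_nauto/(Rstar_autos b_auto)/Rstar_sym.
Qed.

(** The ideals of [constant_star_ideal] and [not_autos_star_ideal] already tell
    the three classes apart. *)
Lemma Jstar_same_class a b : Jstar a b -> same_class a b.
Proof.
move=> ab.
have transfer (I : set (endo (transf n))) : star_ideal I -> I a <-> I b.
  move=> starI; split=> Ic; have := Jstar_ideal_min starI Ic.
    by rewrite ab; apply; apply: mem_Jstar_ideal.
  by rewrite -ab; apply; apply: mem_Jstar_ideal.
split; last exact: transfer constant_star_ideal.
have [na_nb nb_na] := transfer _ not_autos_star_ideal.
by split=> a_auto; apply: contrapT; [move/nb_na | move/na_nb].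
Qed.

End StarClasses.

Unset Implicit Arguments.
Local Open Scope classical_set_scope.

Theorem proposition6p12 (n : nat) (hn : (5 <= n)%N) :
  Dstar_classes (endo (transf n)) =
    [set autos (transf n); E1 n; ~` (autos (transf n) `|` E1 n)] /\
  (forall a b : endo (transf n), Dstar a b <-> Jstar a b).
Proof.
split; last first.
  move=> a b; split; first exact: Dstar_Jstar.
  by move/(Jstar_same_class hn)/(Dstar_iff hn).
have autos_nconst a : autos (transf n) a -> ~ constant_endo a.
  move=> /bij_inj a_inj [e ae]; have [i [j [_ [ij _ _]]]] := distinct_points hn.
  case/eqP: ij; apply: cst_inj; apply: a_inj; by rewrite !ae.
have class_of a (X : set (endo (transf n))) :
    (forall b, X b <-> same_class a b) -> [set b | Dstar a b] = X.
  by move=> XE; apply/seteqP; split=> b /=; rewrite Dstar_iff // XE.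
have D_auto a : autos _ a -> [set b | Dstar a b] = autos (transf n).
  move=> a_auto; apply: class_of => b; rewrite /same_class.
  by have := autos_nconst a; have := autos_nconst b; tauto.
have D_const a : constant_endo a -> [set b | Dstar a b] = E1 n.
  move=> a_const; apply: class_of => b; rewrite E1_constant // /same_class.
  by have := autos_nconst a; have := autos_nconst b; tauto.
have D_rest a : ~ autos _ a -> ~ constant_endo a ->
    [set b | Dstar a b] = ~` (autos (transf n) `|` E1 n).
  move=> a_nauto a_nconst; apply: class_of => b.
  by rewrite /= E1_constant // /same_class; tauto.
apply/seteqP; split=> [_ [a ->]|X /=].
  have [a_auto|a_nauto] := pselect (autos _ a); first by left; left; apply: D_auto.
  have [a_const|a_nconst] := pselect (constant_endo a); first by left; right; apply: D_const.
  by right; apply: D_rest.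
have [x [y [z [xy xz yz]]]] := distinct_points hn.
case=> [[->|->]|->].
- by exists 1%g; rewrite D_auto //; exists id.
- exists (const_endo (mul_cst (cst x) x)); rewrite D_const //.
  by exists (cst x).
- exists (phi_endo (flip_pair xy xz yz)); rewrite D_rest //.
  + move=> /bij_inj f_inj; case/eqP: (xy); apply: cst_inj; apply: f_inj.
    by rewrite /= !(phi_sing _ _ xz) // !cstE.
  + move=> [e fe]; case/eqP: (flip_neq y xz).
    have [s fs] := phi_surj_t hn (flip x y z) (cst x).
    have [s' fs'] := phi_surj_e hn (flip x y z) (cst x).
    by rewrite -[LHS]fs -[RHS]fs' -[LHS]/(phi_endo (flip_pair xy xz yz) s) fe -(fe s').
Qed.
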